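(* There exists a mass problem $\mathcal{Y}$ such that $\mathrm{Th}(\mathfrak{M}_w(\le_w \mathcal{Y}))=\mathrm{IPC}$, where $\mathfrak{M}_w(\le_w\mathcal{Y})$ is the initial segment of the Muchnik lattice consisting of all Muchnik degrees $\le$ the Muchnik degree of $\mathcal{Y}$, regarded as a Brouwer algebra.
   Context: A mass problem is a set of functions $\omega\to\omega$. Muchnik reducibility: $\mathcal{A}\le_w\mathcal{B}$ iff for every $g\in\mathcal{B}$ there is $f\in\mathcal{A}$ with $f\le_T g$ (Turing reducibility). The Muchnik degrees (equivalence classes under $\le_w\cap\ge_w$) form a bounded distributive lattice $\mathfrak{M}_w$ with join $\mathcal{A}+\mathcal{B}=\{f\oplus g: f\in\mathcal{A},g\in\mathcal{B}\}$ ($f\oplus g(2y)=f(y)$, $f\oplus g(2y+1)=g(y)$) and meet $\mathcal{A}\times\mathcal{B}=\{\langle0\rangle^\frown f: f\in\mathcal{A}\}\cup\{\langle1\rangle^\frown g: g\in\mathcal{B}\}$; bottom is the degree of mass problems containing a computable function. A Brouwer algebra is a bounded distributive lattice (bottom $0$, top $1$) such that for all $a,b$ there is a least $a\to b$ with $a+(a\to b)\ge b$; $\neg a=a\to 1$. The interval $\mathfrak{M}_w(\le_w\mathcal{Y})$ of degrees between $0$ and $\deg_w(\mathcal{Y})$ is a Brouwer algebra with bottom $0$, top $\deg_w(\mathcal{Y})$, and $x\to y$ the least $z$ in the interval with $x+z\ge y$. A propositional formula (connectives $\vee,\wedge,\to,\neg$) is true in a Brouwer algebra $B$ if, interpreting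 $\vee$ as the lattice meet, $\wedge$ as the lattice join, and $\to,\neg$ as those of $B$, it evaluates to the bottom element under every assignment of elements of $B$ to its variables; $\mathrm{Th}(B)$ is the set of formulas true in $B$. $\mathrm{IPC}$ is the set of theorems of intuitionistic propositional calculus. *)

(* Defs.v *)
From HB Require Import structures.
From mathcomp Require Import all_boot all_order.
From mathcomp Require Import boolp classical_sets.

Set Implicit Arguments.
Unset Strict Implicit.
Unset Printing Implicit Defensive.

Import Order.TTheory.
Local Open Scope classical_set_scope.

(* Codes for the k-ary partial functions that are mu-recursive in an oracle. *)
Inductive code : nat -> Type :=
| Zero k : code k
| Succ : code 1
| Proj k (i : 'I_k) : code k
| Oracle : code 1
| Comp k m (h : code m) (gs : 'I_m -> code k) : code k
| Prec k (g : code k) (h : code k.+2) : code k.+1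
| Mu k (g : code k.+1) : code k.

(* [eval o c v y]: the partial function with code [c] and oracle [o] is
   defined at [v], with value [y].  The recursion variable of [Prec] and the
   search variable of [Mu] come first; [s] lists the successive values of the
   recursion.  [Mu] requires all values before the first zero to be defined. *)
Fixpoint eval (o : nat -> nat) k (c : code k) : k.-tuple nat -> nat -> Prop :=
  match c in code k return k.-tuple nat -> nat -> Prop with
  | Zero _ => fun _ y => y = 0
  | Succ => fun v y => y = (thead v).+1
  | Proj _ i => fun v y => y = tnth v i
  | Oracle => fun v y => y = o (thead v)
  | Comp _ m h gs => fun v y =>
      exists2 w : m.-tuple nat,
        forall i, eval o (gs i) v (tnth w i) & eval o h w y
  | Prec _ g h => fun v y =>
      exists s : nat -> nat,
        [/\ eval o g [tuple of behead v] (s 0),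
            forall i, i < thead v ->
              eval o h [tuple of i :: s i :: [tuple of behead v]] (s i.+1)
          & y = s (thead v)]
  | Mu _ g => fun v y =>
      eval o g [tuple of y :: v] 0 /\
      forall i, i < y -> exists z, eval o g [tuple of i :: v] z.+1
  end.

Definition turing_le (f g : nat -> nat) : Prop :=
  exists c : code 1, forall n, eval g c [tuple n] (f n).

Definition computable (f : nat -> nat) : Prop := turing_le f (fun=> 0).

(* f (+) g, with (f (+) g)(2y) = f y and (f (+) g)(2y+1) = g y. *)
Definition turing_join (f g : nat -> nat) (n : nat) : nat :=
  if odd n then g n./2 else f n./2.

(* The concatenation <i>^f. *)
Definition fun_cons (i : nat) (f : nat -> nat) (n : nat) : nat :=
  if n is m.+1 then f m else i.

Fixpoint subst_oracle (d : code 1) k (c : code k) : code k :=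
  match c in code k return code k with
  | Zero k => Zero k
  | Succ => Succ
  | Proj _ i => Proj i
  | Oracle => d
  | Comp _ _ h gs => Comp (subst_oracle d h) (fun i => subst_oracle d (gs i))
  | Prec _ g h => Prec (subst_oracle d g) (subst_oracle d h)
  | Mu _ g => Mu (subst_oracle d g)
  end.

Lemma eval_subst_oracle (f g : nat -> nat) (d : code 1) :
  (forall n, eval f d [tuple n] (g n)) ->
  forall k (c : code k) v y, eval g c v y -> eval f (subst_oracle d c) v y.
Proof.
move=> fd k c; elim: {k}c => [k||k i||k m h IHh gs IHgs|k c IHc h IHh|k c IHc]
  v y //=.
- move=> ->; have := fd (thead v); congr (eval _ _ _ _).
  by apply: eq_from_tnth => i; rewrite (ord1 i).
- by move=> [w gsw hw]; exists w => [i|]; [apply: IHgs|apply: IHh].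
- by move=> [s [s0 sS ->]]; exists s; split=> // [|i iv];
    [apply: IHc|apply/IHh/sS].
- by move=> [y0 lty]; split=> [|i /lty[z iz]]; [apply: IHc|exists z; apply: IHc].
Qed.

Lemma turing_le_refl f : turing_le f f.
Proof. by exists Oracle. Qed.

Lemma turing_le_trans f g h : turing_le f g -> turing_le g h -> turing_le f h.
Proof.
move=> [c fc] [d gd]; exists (subst_oracle d c) => n.
exact: eval_subst_oracle gd _ _ _ _ (fc n).
Qed.

Lemma eval_prec o k (g : code k) (h : code k.+2) (v : k.+1.-tuple nat) s :
  eval o g [tuple of behead v] (s 0) ->
  (forall i, eval o h [tuple of i :: s i :: [tuple of behead v]] (s i.+1)) ->
  eval o (Prec g h) v (s (thead v)).
Proof. by move=> s0 sS; exists s; split. Qed.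

Lemma eval_comp1 o k (h : code 1) (g : code k) v x y :
  eval o g v x -> eval o h [tuple x] y -> eval o (Comp h (fun=> g)) v y.
Proof. by move=> gx hy; exists [tuple x] => // i; rewrite (ord1 i). Qed.

Definition comp3 k (h : code 3) (a b c : code k) : code k :=
  Comp h (tnth [tuple a; b; c]).

Lemma eval_comp3 o k (h : code 3) (a b c : code k) v x y z t :
  eval o a v x -> eval o b v y -> eval o c v z ->
  eval o h [tuple x; y; z] t -> eval o (comp3 h a b c) v t.
Proof. by move=> ax byy cz ht; exists [tuple x; y; z] => // -[[|[|[|]]]]. Qed.

Definition code_isz : code 1 := Prec (Comp Succ (fun=> Zero 0)) (Zero 2).
Definition code_odd : code 1 :=
  Prec (Zero 0) (Comp code_isz (fun=> Proj (inord 1 : 'I_2))).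
Definition code_cond : code 3 :=
  Prec (Proj (inord 1 : 'I_2)) (Proj (inord 2 : 'I_4)).
Definition code_half : code 1 :=
  Prec (Zero 0) (comp3 code_cond
    (Comp code_odd (fun=> Proj (inord 0 : 'I_2)))
    (Comp Succ (fun=> Proj (inord 1 : 'I_2))) (Proj (inord 1 : 'I_2))).
Definition code_double : code 1 :=
  Prec (Zero 0)
    (Comp Succ (fun=> Comp Succ (fun=> Proj (inord 1 : 'I_2)))).

Lemma eval_isz o n : eval o code_isz [tuple n] (n == 0).
Proof.
apply: (@eval_prec _ _ _ _ _ (fun n => nat_of_bool (n == 0))) => //.
exact: (@eval_comp1 _ _ _ _ _ 0).
Qed.

Lemma eval_odd o n : eval o code_odd [tuple n] (odd n).
Proof.
apply: (@eval_prec _ _ _ _ _ (fun n => nat_of_bool (odd n))) => // i.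
apply: (@eval_comp1 _ _ _ _ _ (odd i)); first by rewrite /= (tnth_nth 0) inordK.
have := eval_isz o (odd i); congr (eval _ _ _ (nat_of_bool _)).
by rewrite /=; case: odd.
Qed.

Lemma eval_cond o (b : bool) x y :
  eval o code_cond [tuple nat_of_bool b; x; y] (if b then x else y).
Proof.
have -> : (if b then x else y) = if nat_of_bool b != 0 then x else y by case: b.
apply: (@eval_prec _ _ _ _ _ (fun n => if n != 0 then x else y)) => [|i];
  by rewrite /= (tnth_nth 0) inordK.
Qed.

Lemma eval_half o n : eval o code_half [tuple n] n./2.
Proof.
apply: (@eval_prec _ _ _ _ _ half) => // i.
apply: (@eval_comp3 _ _ _ _ _ _ _ (odd i) (i./2.+1) i./2).
- apply: (@eval_comp1 _ _ _ _ _ i); last exact: eval_odd.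
  by rewrite /= (tnth_nth 0) inordK.
- apply: (@eval_comp1 _ _ _ _ _ i./2) => //.
  by rewrite /= (tnth_nth 0) inordK.
- by rewrite /= (tnth_nth 0) inordK.
have := eval_cond o (odd i) i./2.+1 i./2; congr (eval _ _ _ _).
by rewrite /= uphalf_half; case: odd.
Qed.

Lemma eval_double o n : eval o code_double [tuple n] n.*2.
Proof.
apply: (@eval_prec _ _ _ _ _ double) => // i.
apply: (@eval_comp1 _ _ _ _ _ i.*2.+1) => //.
apply: (@eval_comp1 _ _ _ _ _ i.*2) => //.
by rewrite /= (tnth_nth 0) inordK.
Qed.

Lemma turing_le_joinl f g : turing_le f (turing_join f g).
Proof.
exists (Comp Oracle (fun=> code_double)) => n.
apply: eval_comp1 (eval_double _ _) _.
by rewrite /= theadE /turing_join odd_double doubleK.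
Qed.

Lemma turing_le_joinr f g : turing_le g (turing_join f g).
Proof.
exists (Comp Oracle (fun=> Comp Succ (fun=> code_double))) => n.
apply: (@eval_comp1 _ _ _ _ _ n.*2.+1).
  exact: eval_comp1 (eval_double _ _) _.
by rewrite /= theadE /turing_join /= odd_double /= uphalf_double.
Qed.

Lemma turing_join_le f g h :
  turing_le f h -> turing_le g h -> turing_le (turing_join f g) h.
Proof.
move=> [c fc] [d gd].
exists (comp3 code_cond code_odd (Comp d (fun=> code_half))
  (Comp c (fun=> code_half))) => n.
apply: eval_comp3 (eval_odd _ _) _ _ (eval_cond _ _ _ _);
  exact: eval_comp1 (eval_half _ _) _.
Qed.

Fixpoint code_const k i : code k :=
  if i is j.+1 then Comp Succ (fun=> code_const k j) else Zero k.

Lemma eval_const o k i v : eval o (code_const k i) v i.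
Proof.
by elim: i => // i IH; apply: (@eval_comp1 _ _ Succ (code_const k i) _ i).
Qed.

Lemma turing_le_cons i f : turing_le f (fun_cons i f).
Proof.
exists (Comp Oracle (fun=> Succ)) => n; exact: (@eval_comp1 _ _ _ _ _ n.+1).
Qed.

Lemma turing_cons_le i f : turing_le (fun_cons i f) f.
Proof.
exists (Prec (code_const 0 i) (Comp Oracle (fun=> Proj (inord 0 : 'I_2)))) => n.
apply: (@eval_prec _ _ _ _ _ (fun_cons i f)) => [|j]; first exact: eval_const.
by apply: (@eval_comp1 _ _ _ _ _ j) => //=; rewrite (tnth_nth 0) inordK.
Qed.

Lemma computable_le f g : computable f -> turing_le f g.
Proof.
move=> /turing_le_trans; apply.
by exists (Zero 1).
Qed.

(* The order-theoretic dual of a Heyting algebra: the lattice join plays the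
   role of conjunction and the bottom element that of truth. *)
HB.mixin Record TBDistrLattice_isBrouwer d B of Order.TBDistrLattice d B := {
  imp : B -> B -> B;
  le_join_imp : forall a b : B, (b <= a `|` imp a b)%O;
  imp_least : forall a b c : B, (b <= a `|` c)%O -> (imp a b <= c)%O
}.

#[short(type="brouwerType")]
HB.structure Definition Brouwer d :=
  {B of TBDistrLattice_isBrouwer d B & Order.TBDistrLattice d B}.

Definition neg d (B : brouwerType d) (a : B) : B := imp a \top%O.

Section InitialSegment.
Variables (d : Order.disp_t) (B : brouwerType d) (y : B).

Record initial_segment := InitialSegment {
  segment_val :> B;
  segment_valP : (segment_val <= y)%O
}.

HB.instance Definition _ := [isSub of initial_segment for segment_val].
HB.instance Definition _ := [Choice of initial_segment by <:].
HB.instance Definition _ :=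
  [SubChoice_isSubPOrder of initial_segment by <: with d].

Local Notation S := initial_segment.
Implicit Types a b c : S.

Definition segment_meet a b : S :=
  InitialSegment (leIxl (segment_val b) (segment_valP a)).

Fact segment_join_subproof a b : (segment_val a `|` segment_val b <= y)%O.
Proof. by rewrite leUx !segment_valP. Qed.
Definition segment_join a b : S := InitialSegment (segment_join_subproof a b).

Fact segment_imp_subproof a b : (imp (segment_val a) (segment_val b) <= y)%O.
Proof. by apply: le_trans (segment_valP b); apply/imp_least/leUr. Qed.
Definition segment_imp a b : S := InitialSegment (segment_imp_subproof a b).

Fact segment_lexI a b c :
  (a <= segment_meet b c)%O = (a <= b)%O && (a <= c)%O.
Proof. by rewrite -!Order.le_val lexI. Qed.

Fact segment_leUx a b c :
  (segment_join a b <= c)%O = (a <= c)%O && (b <= c)%O.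
Proof. by rewrite -!Order.le_val leUx. Qed.

HB.instance Definition _ :=
  Order.POrder_MeetJoin_isLattice.Build d S segment_lexI segment_leUx.

Fact segment_meetUl : @left_distributive S S Order.meet Order.join.
Proof. by move=> a b c; apply: val_inj; apply: meetUl. Qed.

HB.instance Definition _ :=
  Order.Lattice_Meet_isDistrLattice.Build d S segment_meetUl.

Fact segment_le0x a : (InitialSegment (le0x y) <= a)%O.
Proof. by rewrite -Order.le_val le0x. Qed.
HB.instance Definition _ := Order.hasBottom.Build d S segment_le0x.

Fact segment_lex1 a : (a <= InitialSegment (lexx y))%O.
Proof. by rewrite -Order.le_val segment_valP. Qed.
HB.instance Definition _ := Order.hasTop.Build d S segment_lex1.

Fact segment_le_join_imp a b : (b <= a `|` segment_imp a b)%O.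
Proof. by rewrite -Order.le_val le_join_imp. Qed.
Fact segment_imp_least a b c : (b <= a `|` c)%O -> (segment_imp a b <= c)%O.
Proof. by rewrite -!Order.le_val => /imp_least. Qed.
HB.instance Definition _ :=
  TBDistrLattice_isBrouwer.Build d S segment_le_join_imp segment_imp_least.

End InitialSegment.

Definition mass_problem : Type := set (nat -> nat).

Implicit Types A B C : mass_problem.

Definition muchnik_le A B : Prop :=
  forall g, B g -> exists2 f, A f & turing_le f g.

Definition mass_join A B : mass_problem :=
  [set turing_join f g | f in A & g in B].

Definition mass_meet A B : mass_problem :=
  [set fun_cons 0 f | f in A] `|` [set fun_cons 1 g | g in B].

Definition mass_imp A B : mass_problem :=
  [set g | forall f, A f -> exists2 h, B h & turing_le h (turing_join f g)].

Lemma muchnik_le_refl A : muchnik_le A A.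
Proof. by move=> f Af; exists f => //; apply: turing_le_refl. Qed.

Lemma muchnik_le_trans B A C :
  muchnik_le A B -> muchnik_le B C -> muchnik_le A C.
Proof.
move=> AB BC h /BC[g /AB[f Af fg] gh].
by exists f => //; apply: turing_le_trans gh.
Qed.

Lemma muchnik_le_meet A B C :
  muchnik_le A (mass_meet B C) <-> muchnik_le A B /\ muchnik_le A C.
Proof.
split=> [ABC|[AB AC] _ [[g /AB[f Af fg] <-]|[g /AC[f Af fg] <-]]].
- split=> g Bg.
    have [|f Af fg] := ABC (fun_cons 0 g); first by left; exists g.
    by exists f => //; apply: turing_le_trans fg (turing_cons_le _ _).
  have [|f Af fg] := ABC (fun_cons 1 g); first by right; exists g.
  by exists f => //; apply: turing_le_trans fg (turing_cons_le _ _).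
- by exists f => //; apply: turing_le_trans fg (turing_le_cons _ _).
- by exists f => //; apply: turing_le_trans fg (turing_le_cons _ _).
Qed.

Lemma muchnik_join_le A B C :
  muchnik_le (mass_join A B) C <-> muchnik_le A C /\ muchnik_le B C.
Proof.
split=> [ABC|[AC BC] h Ch].
  split=> h /ABC[_ [f Af [g Bg <-]] fgh].
    by exists f => //; apply: turing_le_trans fgh; apply: turing_le_joinl.
  by exists g => //; apply: turing_le_trans fgh; apply: turing_le_joinr.
have [f Af fh] := AC _ Ch; have [g Bg gh] := BC _ Ch.
by exists (turing_join f g); [exists f => //; exists g|apply: turing_join_le].
Qed.

Lemma muchnik_distr A B C :
  muchnik_le (mass_meet (mass_join A B) C)
             (mass_join (mass_meet A C) (mass_meet B C)).
Proof.
move=> _ [_ [[f Af <-]|[f Cf <-]] [_ [[g Bg <-]|[g Cg <-]] <-]].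
- exists (fun_cons 0 (turing_join f g)).
    by left; exists (turing_join f g) => //; exists f => //; exists g.
  apply: (turing_le_trans (turing_cons_le _ _)); apply: turing_join_le.
    apply: turing_le_trans (turing_le_joinl _ _); exact: turing_le_cons.
  apply: turing_le_trans (turing_le_joinr _ _); exact: turing_le_cons.
- exists (fun_cons 1 g); first by right; exists g.
  apply: (turing_le_trans (turing_cons_le _ _)).
  apply: turing_le_trans (turing_le_joinr _ _); exact: turing_le_cons.
- exists (fun_cons 1 f); first by right; exists f.
  apply: (turing_le_trans (turing_cons_le _ _)).
  apply: turing_le_trans (turing_le_joinl _ _); exact: turing_le_cons.
- exists (fun_cons 1 f); first by right; exists f.
  apply: (turing_le_trans (turing_cons_le _ _)).
  apply: turing_le_trans (turing_le_joinl _ _); exact: turing_le_cons.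
Qed.

Lemma muchnik_le_join_imp A B : muchnik_le B (mass_join A (mass_imp A B)).
Proof. by move=> _ [f Af [g /(_ _ Af) ? <-]]. Qed.

Lemma muchnik_imp_least A B C :
  muchnik_le B (mass_join A C) -> muchnik_le (mass_imp A B) C.
Proof.
move=> BAC g Cg; exists g; last exact: turing_le_refl.
by move=> f Af; apply: BAC; exists f => //; exists g.
Qed.

HB.instance Definition _ := Choice.copy mass_problem (set (nat -> nat)).

Definition muchnik_eq A B : bool := `[< muchnik_le A B /\ muchnik_le B A >].

Fact muchnik_eq_refl : reflexive muchnik_eq.
Proof. by move=> A; apply/asboolP; split; apply: muchnik_le_refl. Qed.
Fact muchnik_eq_sym : symmetric muchnik_eq.
Proof. by move=> A B; apply/asboolP/asboolP => -[]. Qed.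
Fact muchnik_eq_trans : transitive muchnik_eq.
Proof.
move=> B A C /asboolP[AB BA] /asboolP[BC CB]; apply/asboolP.
by split; [apply: muchnik_le_trans BC|apply: muchnik_le_trans BA].
Qed.

Canonical muchnik_equiv :=
  EquivRel muchnik_eq muchnik_eq_refl muchnik_eq_sym muchnik_eq_trans.

Definition muchnik_degree : Type := {eq_quot muchnik_equiv}%qT.
HB.instance Definition _ := Choice.copy muchnik_degree {eq_quot muchnik_equiv}%qT.

Definition deg (A : mass_problem) : muchnik_degree :=
  (\pi_{eq_quot muchnik_equiv} A)%qT.
Definition representative (x : muchnik_degree) : mass_problem :=
  repr (x : {eq_quot muchnik_equiv}%qT).

Lemma representativeK : cancel representative deg.
Proof. by move=> x; rewrite /deg reprK. Qed.

Lemma deg_eq A B : deg A = deg B <-> muchnik_le A B /\ muchnik_le B A.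
Proof. by split=> [/eqmodP/asboolP|AB]; last exact/eqmodP/asboolP. Qed.

Lemma representative_deg A :
  muchnik_le A (representative (deg A)) /\ muchnik_le (representative (deg A)) A.
Proof. by apply/deg_eq; rewrite representativeK. Qed.

Fact muchnik_display : Order.disp_t. Proof. exact: Order.Disp tt tt. Qed.

Section MuchnikLattice.
Implicit Types x y z : muchnik_degree.

Definition degree_le x y : bool :=
  `[< muchnik_le (representative x) (representative y) >].

Fact degree_le_refl : reflexive degree_le.
Proof. by move=> x; apply/asboolP/muchnik_le_refl. Qed.
Fact degree_le_anti : antisymmetric degree_le.
Proof.
move=> x y /andP[/asboolP xy /asboolP yx].
by rewrite -[x]representativeK -[y]representativeK; apply/deg_eq.
Qed.
Fact degree_le_trans : transitive degree_le.
Proof.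
by move=> y x z /asboolP xy /asboolP yz; apply/asboolP/(muchnik_le_trans xy).
Qed.

HB.instance Definition _ := Order.Le_isPOrder.Build muchnik_display muchnik_degree
  degree_le_refl degree_le_anti degree_le_trans.

Lemma degree_leP x y :
  reflect (muchnik_le (representative x) (representative y)) (x <= y)%O.
Proof. exact: asboolP. Qed.

Lemma deg_leP A B : reflect (muchnik_le A B) (deg A <= deg B)%O.
Proof.
have [A1 A2] := representative_deg A; have [B1 B2] := representative_deg B.
apply: (iffP (degree_leP _ _)) => AB.
  exact: muchnik_le_trans A1 (muchnik_le_trans AB B2).
exact: muchnik_le_trans A2 (muchnik_le_trans AB B1).
Qed.

Definition degree_meet x y := deg (mass_meet (representative x) (representative y)).
Definition degree_join x y := deg (mass_join (representative x) (representative y)).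
Definition degree_imp x y := deg (mass_imp (representative x) (representative y)).

Fact degree_lexI x y z :
  (x <= degree_meet y z)%O = (x <= y)%O && (x <= z)%O.
Proof.
rewrite -[in LHS](representativeK x); apply/deg_leP/andP => [/muchnik_le_meet|].
  by case=> xy xz; split; apply/degree_leP.
by case=> /degree_leP xy /degree_leP xz; apply/muchnik_le_meet.
Qed.

Fact degree_leUx x y z :
  (degree_join x y <= z)%O = (x <= z)%O && (y <= z)%O.
Proof.
rewrite -[in LHS](representativeK z); apply/deg_leP/andP => [/muchnik_join_le|].
  by case=> xz yz; split; apply/degree_leP.
by case=> /degree_leP xz /degree_leP yz; apply/muchnik_join_le.
Qed.

HB.instance Definition _ := Order.POrder_MeetJoin_isLattice.Build
  muchnik_display muchnik_degree degree_lexI degree_leUx.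

Lemma deg_meet A B : deg (mass_meet A B) = (deg A `&` deg B)%O.
Proof.
apply/le_anti; rewrite lexI; apply/andP; split.
  by apply/andP; split; apply/deg_leP;
    have /muchnik_le_meet[] := @muchnik_le_refl (mass_meet A B).
rewrite -[(_ `&` _)%O]representativeK; apply/deg_leP/muchnik_le_meet.
by split; apply/deg_leP; rewrite representativeK ?leIl ?leIr.
Qed.

Lemma deg_join A B : deg (mass_join A B) = (deg A `|` deg B)%O.
Proof.
apply/le_anti; rewrite leUx andbC; apply/andP; split.
  by apply/andP; split; apply/deg_leP;
    have /muchnik_join_le[] := @muchnik_le_refl (mass_join A B).
rewrite -[(_ `|` _)%O]representativeK; apply/deg_leP/muchnik_join_le.
by split; apply/deg_leP; rewrite representativeK ?leUl ?leUr.
Qed.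

Fact degree_meetUl :
  @left_distributive muchnik_degree muchnik_degree Order.meet Order.join.
Proof.
move=> x y z; apply/le_anti; apply/andP; split; last first.
  by rewrite leUx !leI2 ?leUl ?leUr.
rewrite -[x]representativeK -[y]representativeK -[z]representativeK.
rewrite -!(deg_meet, deg_join); apply/deg_leP; exact: muchnik_distr.
Qed.

HB.instance Definition _ := Order.Lattice_Meet_isDistrLattice.Build
  muchnik_display muchnik_degree degree_meetUl.

Fact degree_le0x x : (deg [set f | computable f] <= x)%O.
Proof.
rewrite -[x]representativeK; apply/deg_leP => g _.
exists (fun=> 0); last by exists (Zero 1).
by exists (Zero 1).
Qed.
HB.instance Definition _ :=
  Order.hasBottom.Build muchnik_display muchnik_degree degree_le0x.

Fact degree_lex1 x : (x <= deg set0)%O.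
Proof. by rewrite -[x]representativeK; apply/deg_leP => g []. Qed.
HB.instance Definition _ :=
  Order.hasTop.Build muchnik_display muchnik_degree degree_lex1.

Fact degree_le_join_imp x y : (y <= x `|` degree_imp x y)%O.
Proof.
rewrite -{1}[x]representativeK -deg_join -{1}[y]representativeK.
exact/deg_leP/muchnik_le_join_imp.
Qed.
Fact degree_imp_least x y z : (y <= x `|` z)%O -> (degree_imp x y <= z)%O.
Proof.
rewrite -{1}[x]representativeK -{1}[y]representativeK -[z]representativeK.
by rewrite -deg_join => /deg_leP ?; apply/deg_leP/muchnik_imp_least.
Qed.
HB.instance Definition _ := TBDistrLattice_isBrouwer.Build
  muchnik_display muchnik_degree degree_le_join_imp degree_imp_least.

End MuchnikLattice.

Lemma deg_eq_bot A :
  deg A = \bot%O <-> exists2 f, A f & computable f.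
Proof.
split=> [/deg_eq[+ _] | [f Af cf]].
  case/(_ (fun=> 0)); first by exists (Zero 1).
  by move=> f; exists f.
apply/deg_eq; split=> [g _|g _]; first by exists f => //; apply: computable_le.
by exists (fun=> 0); exists (Zero 1).
Qed.

Inductive formula : Type :=
| Var (n : nat)
| Or (p q : formula)
| And (p q : formula)
| Imp (p q : formula)
| Not (p : formula).

(* Disjunction is the meet and conjunction the join: truth is [\bot]. *)
Fixpoint interp d (B : brouwerType d) (v : nat -> B) (p : formula) : B :=
  match p with
  | Var n => v n
  | Or p q => interp v p `&` interp v q
  | And p q => interp v p `|` interp v q
  | Imp p q => imp (interp v p) (interp v q)
  | Not p => neg (interp v p)
  end%O.

Definition Th d (B : brouwerType d) : set formula :=
  [set p | forall v : nat -> B, interp v p = \bot%O].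

(* Natural deduction for intuitionistic propositional logic. *)
Inductive derivable : set formula -> formula -> Prop :=
| d_hyp (G : set formula) p of G p : derivable G p
| d_or_introl G p q of derivable G p : derivable G (Or p q)
| d_or_intror G p q of derivable G q : derivable G (Or p q)
| d_or_elim G p q r of derivable G (Or p q)
    & derivable (p |` G) r & derivable (q |` G) r : derivable G r
| d_and_intro G p q of derivable G p & derivable G q : derivable G (And p q)
| d_and_eliml G p q of derivable G (And p q) : derivable G p
| d_and_elimr G p q of derivable G (And p q) : derivable G q
| d_imp_intro G p q of derivable (p |` G) q : derivable G (Imp p q)
| d_imp_elim G p q of derivable G (Imp p q) & derivable G p : derivable G q
| d_not_intro G p q of derivable (p |` G) q & derivable (p |` G) (Not q) :
    derivable G (Not p)
| d_not_elim G p q of derivable G p & derivable G (Not p) : derivable G q.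

Definition IPC : set formula := [set p | derivable set0 p].

(* Main.v *)
From HB Require Import structures.
Require Import Defs.
From mathcomp Require Import all_boot all_order.
From mathcomp Require Import boolp classical_sets.

Set Implicit Arguments.
Unset Strict Implicit.
Unset Printing Implicit Defensive.

Import Order.TTheory.
Local Open Scope classical_set_scope.

(* The degrees below deg Y, where Y is the complement of a Turing-downset P, are
   the up-closed subsets of P, so Th of the segment is the logic of the Kripke
   frame P.  We choose P with a p-morphism onto the tree of finite sequences of
   naturals, for which IPC is complete (canonical model of saturated theories,
   unravelled along the countably many extension steps).

   Take a sufficiently Cohen-generic f whose arguments are split into columns
   indexed by sequences, and let f_s be f restricted to the columns of the
   prefixes of s.  The ideal I_s is generated by f_s and by a tower of oracles
   H_0 <= H_1 <= ..., and P is the union of the I_s.  By mutual genericity, I_s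
   and I_t meet exactly in the ideal of the longest common prefix of s and t, so
   each x in P has a least s with x in I_s; this s is its image in the tree.
   The usual argument computes x in the intersection by searching for a
   convergent computation from an extension of a finite condition.  The tower
   makes this search trivial: H_(k+1) is allowed to be any function that answers
   the search questions about H_k, so no universal machine is needed. *)

(** * Use principle, determinism and countability of codes *)

Definition agree (m : nat) (f g : nat -> nat) : Prop :=
  forall j, j < m -> f j = g j.

Lemma agree_leq m n f g : m <= n -> agree n f g -> agree m f g.
Proof. by move=> mn fg j jm; apply/fg/(leq_trans jm). Qed.

Lemma agree_trans m f g h : agree m f g -> agree m g h -> agree m f h.
Proof. by move=> fg gh j jm; rewrite fg ?gh. Qed.

Lemma agree_sym m f g : agree m f g -> agree m g f.
Proof. by move=> fg j jm; rewrite fg. Qed.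

Lemma agree_ltn_forall (o : nat -> nat) n (Q : nat -> (nat -> nat) -> Prop) :
  (forall i, i < n -> exists m, forall o', agree m o o' -> Q i o') ->
  exists m, forall o', agree m o o' -> forall i, i < n -> Q i o'.
Proof.
elim: n => [|n IH] Qn; first by exists 0.
have [m Qm] := IH (fun i lt => Qn i (ltnW lt)).
have [m' Qm'] := Qn n (ltnSn n).
exists (maxn m m') => o' oo' i; rewrite ltnS leq_eqVlt => /orP[/eqP->|].
  by apply: Qm'; apply: agree_leq oo'; apply: leq_maxr.
by apply: Qm; apply: agree_leq oo'; apply: leq_maxl.
Qed.

(** A halting computation consults finitely many oracle values; the bounds of its subcomputations
    are combined by taking maxima. *)
Lemma eval_use k (c : code k) o v y :
  eval o c v y -> exists m, forall o', agree m o o' -> eval o' c v y.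
Proof.
elim: {k}c v y => [k||k i||k m h IHh gs IHgs|k g IHg h IHh|k g IHg] v y /=.
- by move=> ->; exists 0.
- by move=> ->; exists 0.
- by move=> ->; exists 0.
- by move=> ->; exists (thead v).+1 => o' ->.
- move=> [w gsw /IHh[m1 hw]].
  have [|m2 gw] := @agree_ltn_forall o m
      (fun i o' => forall im : i < m, eval o' (gs (Ordinal im)) v (tnth w (Ordinal im))).
    move=> i im; have [m' gm'] := IHgs _ _ _ (gsw (Ordinal im)).
    by exists m' => o' /gm' + im'; rewrite (bool_irrelevance im' im).
  exists (maxn m1 m2) => o' oo'; exists w; last first.
    by apply: hw; apply: agree_leq oo'; apply: leq_maxl.
  move=> [i im]; apply: gw => //.
  by apply: agree_leq oo'; apply: leq_maxr.
- move=> [s [/IHg[m1 s0] sS ->]].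
  have [|m2 hs] := @agree_ltn_forall o (thead v) (fun i o' =>
      eval o' h [tuple of i :: s i :: [tuple of behead v]] (s i.+1)).
    by move=> i /sS/IHh.
  exists (maxn m1 m2) => o' oo'; exists s; split => //.
    by apply: s0; apply: agree_leq oo'; apply: leq_maxl.
  by apply: hs; apply: agree_leq oo'; apply: leq_maxr.
- move=> [/IHg[m1 g0] gS].
  have [|m2 gs] := @agree_ltn_forall o y (fun i o' =>
      exists z, eval o' g [tuple of i :: v] z.+1).
    by move=> i /gS[z /IHg[m' gz]]; exists m' => o' /gz; exists z.
  exists (maxn m1 m2) => o' oo'; split.
    by apply: g0; apply: agree_leq oo'; apply: leq_maxl.
  by apply: gs; apply: agree_leq oo'; apply: leq_maxr.
Qed.

Lemma eval_inj k (c : code k) o v y z : eval o c v y -> eval o c v z -> y = z.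
Proof.
elim: {k}c v y z => [k||k i||k m h IHh gs IHgs|k g IHg h IHh|k g IHg] v y z /=.
- by move=> -> ->.
- by move=> -> ->.
- by move=> -> ->.
- by move=> -> ->.
- move=> [w gw hw] [w' gw' hw']; have ww' : w = w'.
    by apply: eq_from_tnth => i; apply: IHgs (gw i) (gw' i).
  by apply: IHh hw _; rewrite ww'.
- move=> [s [s0 sS ->]] [t [t0 tS ->]].
  suff /(_ (thead v) (leqnn _)) : forall i, i <= thead v -> s i = t i by [].
  elim=> [_|i IHi iv]; first exact: IHg s0 t0.
  have := tS _ iv; rewrite -IHi 1?ltnW // => tS'.
  exact: IHh (sS _ iv) tS'.
- move=> [gy ly] [gz lz]; case: (ltngtP y z) => // [/lz|/ly] [u gu].
    by have := IHg _ _ _ gy gu.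
  by have := IHg _ _ _ gz gu.
Qed.

(** Enumerating codes takes only a surjection from a countable type, so ill-formed parts may decode
    to [Zero]. Labels from 5 on stand for [Comp], the excess over 5 being the arity of the outer
    code. *)
Fixpoint code_of_tree (t : GenTree.tree nat) : forall k, code k :=
  match t with
  | GenTree.Leaf i => fun k =>
      if insub i is Some j then Proj j else Zero k
  | GenTree.Node n ts =>
      let cs := map code_of_tree ts in
      fun k => match n with
      | 0 => Zero k
      | 1 => if k is 1 then Succ else Zero _
      | 2 => if k is 1 then Oracle else Zero _
      | 3 => if k is j.+1 then Prec (nth Zero cs 0 j) (nth Zero cs 1 j.+2)
             else Zero _
      | 4 => Mu (nth Zero cs 0 k.+1)
      | m.+4.+1 => Comp (nth Zero cs 0 m) (fun i : 'I_m => nth Zero cs i.+1 k)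
      end
  end.

Lemma code_of_tree_surj k (c : code k) : exists t, code_of_tree t k = c.
Proof.
elim: {k}c => [k||k i||k m h [th eh] gs IH|k g [tg eg] h [th eh]|k g [tg eg]].
- by exists (GenTree.Node 0 [::]).
- by exists (GenTree.Node 1 [::]).
- by exists (GenTree.Leaf (i : nat)) => /=; rewrite valK.
- by exists (GenTree.Node 2 [::]).
- have [tgs egs] := choice IH.
  exists (GenTree.Node m.+4.+1 (th :: codom tgs)); rewrite /= eh; congr Comp.
  apply/funext => i; rewrite (nth_map (GenTree.Leaf 0)); last first.
    by rewrite size_codom card_ord.
  by rewrite codomE (nth_map i) ?size_enum_ord // nth_ord_enum egs.
- by exists (GenTree.Node 3 [:: tg; th]); rewrite /= eg eh.
- by exists (GenTree.Node 4 [:: tg]); rewrite /= eg.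
Qed.

(** * Pairing, countable upper bounds and unbounded search *)

Definition npair (a b : nat) : nat := 2 ^ a * b.*2.+1.
Definition nunpair (q : nat) : nat * nat :=
  (logn 2 q, (q %/ 2 ^ logn 2 q)./2).

Lemma npairK a b : nunpair (npair a b) = (a, b).
Proof.
have e : logn 2 (npair a b) = a.
  rewrite lognM ?expn_gt0 // pfactorK // lognE /= dvdn2 /= odd_double.
  by rewrite addn0.
by rewrite /nunpair e mulKn ?expn_gt0 //= uphalf_double.
Qed.

Definition code_npair : code 2 :=
  Prec (Comp Succ (fun=> code_double))
       (Comp code_double (fun=> Proj (inord 1 : 'I_3))).

Lemma eval_npair o a b : eval o code_npair [tuple a; b] (npair a b).
Proof.
apply: (@eval_prec _ _ _ _ _ (fun a => npair a b)) => [|i].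
  apply: (@eval_comp1 _ _ _ _ _ b.*2); last by rewrite /= theadE /npair mul1n.
  have := eval_double o b; congr (eval _ _ _ _).
  by apply/val_inj.
apply: (@eval_comp1 _ _ _ _ _ (npair i b)).
  by rewrite /= (tnth_nth 0) inordK.
by rewrite /npair expnS -mulnA mul2n; apply: eval_double.
Qed.

Definition comp2 k (h : code 2) (a b : code k) : code k :=
  Comp h (tnth [tuple a; b]).

Lemma eval_comp2 o k (h : code 2) (a b : code k) v x y t :
  eval o a v x -> eval o b v y -> eval o h [tuple x; y] t ->
  eval o (comp2 h a b) v t.
Proof. by move=> ax byy ht; exists [tuple x; y] => // -[[|[|]]]. Qed.

(** The bound is the infinite direct sum; its summand [i] is read through [npair i]. *)
Lemma turing_le_countable_ub (F : nat -> nat -> nat) :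
  exists f, forall i, turing_le (F i) f.
Proof.
exists (fun q => F (nunpair q).1 (nunpair q).2) => i.
exists (Comp Oracle (fun=> comp2 code_npair (code_const 1 i) (Proj ord0))) => n.
apply: (@eval_comp1 _ _ _ _ _ (npair i n)).
  by apply: eval_comp2 (eval_const _ _ _) _ (eval_npair _ _ _).
by have -> : F i n = F (nunpair (npair i n)).1 (nunpair (npair i n)).2
  by rewrite npairK.
Qed.

(** [test] and [val] receive [g m] and not [m]; below, [g] lists initial segments of a generic.
    Every hit yields the right value, so the least one, found by [Mu], does. *)
Lemma turing_le_search (x g test val o : nat -> nat) :
  turing_le test o -> turing_le val o -> turing_le g o ->
  (forall n, exists m, test (npair n (g m)) = 0) ->
  (forall n m, test (npair n (g m)) = 0 -> val (npair n (g m)) = x n) ->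
  turing_le x o.
Proof.
move=> [ct et] [cv ev] [cg eg] ex ok.
pose q := comp2 code_npair (Proj (inord 1 : 'I_2))
                (Comp cg (fun=> Proj (inord 0 : 'I_2))).
have eq m n : eval o q [tuple m; n] (npair n (g m)).
  apply: eval_comp2 (eval_npair _ _ _).
    by rewrite /= (tnth_nth 0) inordK.
  by apply: eval_comp1 (eg m); rewrite /= (tnth_nth 0) inordK.
exists (comp2 (Comp cv (fun=> q)) (Mu (Comp ct (fun=> q))) (Proj ord0)) => n.
have exb : exists m, test (npair n (g m)) == 0.
  by have [m /eqP] := ex n; exists m.
have [m /eqP tm mmin] := ex_minnP exb.
apply: (@eval_comp2 _ _ _ _ _ _ m n) => //; last first.
  by apply: eval_comp1 (eq m n) _; rewrite -(ok n m tm).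
split; first by apply: eval_comp1 (eq m n) _; have := et (npair n (g m)); rewrite tm.
move=> i im; exists (test (npair n (g i))).-1.
apply: eval_comp1 (eq i n) _; rewrite prednK // lt0n.
by apply: contraL im => /mmin; rewrite leqNgt.
Qed.

Lemma turing_le_comp f g o :
  turing_le f o -> turing_le g o -> turing_le (fun n => f (g n)) o.
Proof.
move=> [c fc] [d gd]; exists (Comp c (fun=> d)) => n.
exact: eval_comp1 (gd n) (fc _).
Qed.

Lemma turing_le_countable_family (T : countType) (F : T -> nat -> nat) :
  exists f, forall i, turing_le (F i) f.
Proof.
have [f ubf] := turing_le_countable_ub
  (fun i => if unpickle i is Some t then F t else fun=> 0).
by exists f => t; have := ubf (pickle t); rewrite pickleK.
Qed.

(** * Generic functions *)

(** Finite extension method: [D i f m] concerns only the first [m] values of [f]. Each stage meets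
    one requirement if some extension of the current condition does; otherwise that condition
    excludes it for good. *)
Lemma exists_generic (T : countType) (D : T -> (nat -> nat) -> nat -> Prop) :
  (forall i m f g, agree m f g -> D i f m -> D i g m) ->
  exists f, forall i, (exists m, D i f m) \/
    exists m, forall g n, m <= n -> agree m f g -> ~ D i g n.
Proof.
move=> Dagree.
pose D' i := if unpickle i is Some t then D t else fun _ _ => False.
(* A condition is a function together with the length up to which it counts. *)
pose E i (p q : (nat -> nat) * nat) := [/\ p.2 < q.2, agree p.2 p.1 q.1 &
  (exists2 m, m <= q.2 & D' i q.1 m) \/
  forall g n, p.2 <= n -> agree p.2 p.1 g -> ~ D' i g n].
have /choice[next nextP] : forall ip : nat * ((nat -> nat) * nat),
    exists q, E ip.1 ip.2 q.
  move=> [i [f m]] /=.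
  have [[g [n [mn fg Dg]]]|no] :=
      pselect (exists g n, [/\ m <= n, agree m f g & D' i g n]).
    by exists (g, n.+1); split => //; left; exists n.
  exists (f, m.+1); split=> //; right=> g n mn fg Dg.
  by apply: no; exists g, n.
pose u := fix u i := if i is j.+1 then next (j, u j) else ((fun=> 0), 0).
have uE i : E i (u i) (u i.+1) by exact: (nextP (i, u i)).
have u2 i : i <= (u i).2.
  by elim: i => // i IH; have [lt _ _] := uE i; apply: leq_ltn_trans lt.
have ule i d : (u i).2 <= (u (i + d)).2 /\ agree (u i).2 (u i).1 (u (i + d)).1.
  elim: d => [|d [le ag]]; first by rewrite addn0.
  rewrite addnS; have [lt ag' _] := uE (i + d).
  split; first by apply: leq_trans le (ltnW lt).
  by apply: agree_trans ag (agree_leq le ag').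
(* At stage [j.+1] the length exceeds [j], so this value is settled. *)
pose f j := (u j.+1).1 j.
have fu i : agree (u i).2 f (u i).1.
  move=> j ji; rewrite /f; have [ij|ij] := leqP i j.+1.
    by have [_ ->] := ule i (j.+1 - i); rewrite ?subnKC.
  by have [_ ->] := ule j.+1 (i - j.+1); rewrite ?subnKC // ltnW.
exists f => t; have [_ _] := uE (pickle t).
rewrite /D' pickleK => -[[m mle Dm]|no]; [left|right].
  exists m; apply: Dagree Dm; apply/agree_sym/agree_leq/fu.
  exact: mle.
exists (u (pickle t)).2 => g n le ag; apply: no le _.
exact: agree_trans (agree_sym (fu _)) ag.
Qed.

(** * Masked oracles and forcing by finite conditions *)

Definition masked (A : pred nat) (f : nat -> nat) (j : nat) : nat :=
  if A j then f j else 0.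

(* Values code whole initial segments, so that a single query to [hist f] hands
   an initial segment of [f] to an arbitrary oracle. *)
Definition hist (f : nat -> nat) (m : nat) : nat := pickle (mkseq f m).

Lemma eq_mkseq_agree m f g : agree m f g -> mkseq f m = mkseq g m.
Proof.
by move=> fg; apply/eq_in_map => j; rewrite mem_iota => /andP[_]; apply: fg.
Qed.

Lemma hist_agree m f g : agree m f g -> agree m (hist f) (hist g).
Proof.
by move=> fg j jm; congr pickle; apply/eq_mkseq_agree/agree_leq/fg/ltnW.
Qed.

Lemma hist_inj m n f g : hist f m = hist g n -> m = n /\ agree m f g.
Proof.
move=> /(pcan_inj pickleK) e.
have mn : m = n by have := congr1 size e; rewrite !size_mkseq.
split=> // j jm; have := congr1 (nth 0 ^~ j) e.
by rewrite !nth_mkseq // -mn.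
Qed.

Lemma masked_agree A m f g : agree m f g -> agree m (masked A f) (masked A g).
Proof. by move=> fg j jm; rewrite /masked fg. Qed.

(** This acts on codes of finite sequences without mentioning the generic, so an oracle chosen
    before the generic can compute it. *)
Definition remasked (A : pred nat) (e : nat) : nat :=
  if unpickle e is Some s then hist (masked A (nth 0 s)) (size s) else 0.

Lemma remasked_hist (A B : pred nat) f m :
  subpred A B -> remasked A (hist (masked B f) m) = hist (masked A f) m.
Proof.
move=> AB; rewrite /remasked /hist pickleK; congr pickle; rewrite size_mkseq.
apply: eq_mkseq_agree => j jm; rewrite /masked nth_mkseq //.
by case: ifP => // /AB ->.
Qed.

Definition oracle_over (h : nat -> nat) (A : pred nat) (f : nat -> nat) :=
  turing_join h (hist (masked A f)).

Definition forces h A (c : code 1) n y f m : Prop :=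
  forall g, agree m f g -> eval (oracle_over h A g) c [tuple n] y.

Lemma forces_use h A c n y f :
  eval (oracle_over h A f) c [tuple n] y -> exists m, forces h A c n y f m.
Proof.
move=> /eval_use[m ev]; exists m => g fg; apply: ev => j jm.
rewrite /oracle_over /turing_join; case: ifP => // _.
apply: (hist_agree (masked_agree A fg)).
by apply: leq_ltn_trans jm; rewrite -[leqRHS]odd_double_half -addnn addnA leq_addl.
Qed.

(** The oracle sees only [A]: an extension [k] of [g] may be replaced by [f'], which follows [f]
    below [m] and [k] from there on. *)
Lemma forces_masked h A c n y f g m :
  agree m (masked A f) (masked A g) -> forces h A c n y f m -> forces h A c n y g m.
Proof.
move=> fg ff k gk; pose f' j := if j < m then f j else k j.
have -> : oracle_over h A k = oracle_over h A f'.
  congr (turing_join _ (hist _)); apply/funext => j; rewrite /masked /f'.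
  case: ifP => // Aj; case: ifP => // jm; rewrite -(gk j jm).
  by have := fg j jm; rewrite /masked Aj.
by apply: ff => j jm; rewrite /f' jm.
Qed.

Lemma forces_leq h A c n y f m m' :
  m <= m' -> forces h A c n y f m -> forces h A c n y f m'.
Proof. by move=> mm' ff g /(agree_leq mm')/ff. Qed.

Lemma forces_inj h A c n y z f m :
  forces h A c n y f m -> eval (oracle_over h A f) c [tuple n] z -> y = z.
Proof. by move=> ff; apply: eval_inj; apply: ff. Qed.

(* With [A] and [B] the column sets of two ideals, genericity for [splits] gives
   the intersection property and genericity for [mispredicts] gives properness. *)
Definition splits h A B c d f m : Prop := exists n y z,
  [/\ y <> z, forces h A c n y f m & forces h B d n z f m].

Definition mispredicts h A B c f m : Prop := exists n y,
  [/\ n <= m, forces h B c n y f m & y <> hist (masked A f) n].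

(* [q] codes a pair (n, e), with [e] an initial segment of the generic on the
   columns common to [A] and [B]; [p] is the condition excluding splittings. *)
Definition answer h (A B : pred nat) c (p : seq nat) (q y : nat) : Prop :=
  exists f m, [/\ hist (masked (predI A B) f) m = (nunpair q).2,
    agree (size p) (nth 0 p) f, size p <= m
    & forces h A c (nunpair q).1 y f m].

(** Zero means success, since the search looks for a zero. The decision is classical; the next
    oracle of the tower supplies it. *)
Definition has_answer h A B c p (q : nat) : nat :=
  if `[< exists y, answer h A B c p q y >] then 0 else 1.

Definition some_answer h A B c p (q : nat) : nat :=
  xget 0 [set y | answer h A B c p q y].

Lemma splits_agree h A B c d m f g :
  agree m f g -> splits h A B c d f m -> splits h A B c d g m.
Proof.
move=> fg [n [y [z [yz fy fz]]]]; exists n, y, z; split=> //.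
  exact: forces_masked (masked_agree _ fg) fy.
exact: forces_masked (masked_agree _ fg) fz.
Qed.

Lemma mispredicts_agree h A B c m f g :
  agree m f g -> mispredicts h A B c f m -> mispredicts h A B c g m.
Proof.
move=> fg [n [y [nm fy yn]]]; exists n, y; split=> //.
  exact: forces_masked (masked_agree _ fg) fy.
suff <- : hist (masked A f) n = hist (masked A g) n by [].
by congr pickle; apply/eq_mkseq_agree/masked_agree/agree_leq/fg.
Qed.

(** To find [x n], search the initial segments of the generic on the common columns for one
    admitting an answer. A wrong answer, combined with the true computation over [B], would give a
    splitting beyond [m]. *)
Lemma turing_le_intersection h A B c d f m x o :
  (forall g n, m <= n -> agree m f g -> ~ splits h A B c d g n) ->
  (forall n, eval (oracle_over h A f) c [tuple n] (x n)) ->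
  (forall n, eval (oracle_over h B f) d [tuple n] (x n)) ->
  turing_le (has_answer h A B c (mkseq f m)) o ->
  turing_le (some_answer h A B c (mkseq f m)) o ->
  turing_le (hist (masked (predI A B) f)) o ->
  turing_le x o.
Proof.
move=> nosplit xA xB oh os of_.
have correct n k y : answer h A B c (mkseq f m)
    (npair n (hist (masked (predI A B) f) k)) y -> y = x n.
  rewrite /answer npairK size_mkseq /=.
  move=> [g [k' [/hist_inj[-> fg] pg mk fy]]].
  have {}pg : agree m f g by move=> j jm; rewrite -pg // nth_mkseq.
  have [l fx] := forces_use (xB n).
  (* [u] follows [g] on [A] and the generic elsewhere: a splitting if y <> x n. *)
  pose u j := if A j then (if j < k then g j else f j) else f j.
  have ug : agree k (masked A g) (masked A u).
    by move=> j jk; rewrite /masked /u jk; case: (A j).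
  (* Below [k], [g] and [f] agree on the columns common to [A] and [B]; everywhere else on [B], [u]
     is [f] by definition. *)
  have uf : masked B f = masked B u.
    apply/funext => j; rewrite /masked /u; case Bj: (B j) => //.
    case Aj: (A j) => //; case: ifP => // jk.
    by have := fg j jk; rewrite /masked /= Aj Bj.
  apply: contrapT => yx; apply: (nosplit u (maxn k l)).
  - by rewrite leq_max mk.
  - by move=> j jm; rewrite /u; case: ifP => // _; case: ifP => // _; apply: pg.
  exists n, y, (x n); split=> //.
    by apply: forces_leq (leq_maxl _ _) _; apply: forces_masked fy.
  by apply: forces_leq (leq_maxr _ _) _; apply: forces_masked fx; rewrite uf.
apply: (turing_le_search oh os of_) => [n|n k]; last first.
  rewrite /has_answer; case: asboolP => // -[y yP] _.
  by apply: (correct n k); rewrite /some_answer; case: xgetP => [? -> //|/(_ y)].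
(* The search succeeds because [f] itself witnesses an answer. *)
have [k fx] := forces_use (xA n); exists (maxn m k).
rewrite /has_answer; case: asboolP => // -[]; exists (x n).
exists f, (maxn m k); rewrite npairK size_mkseq leq_maxl; split=> //.
  by move=> j jm; rewrite nth_mkseq.
by apply: forces_leq fx; apply: leq_maxr.
Qed.

(** Changing [f] at one place of [A] outside [B] and beyond [m] alters the history but not the
    oracle, so a correct reduction would yield a misprediction that [m] excludes. *)
Lemma not_turing_le_masked h A B f :
  (forall m, exists2 j, m <= j & A j && ~~ B j) ->
  (forall c, (exists m, mispredicts h A B c f m) \/
     exists m, forall g n, m <= n -> agree m f g -> ~ mispredicts h A B c g n) ->
  ~ turing_le (hist (masked A f)) (oracle_over h B f).
Proof.
move=> inf gen [c fc]; have [[m [n [y [_ fy ny]]]]|[m no]] := gen c.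
  exact/ny/(forces_inj fy).
have [j mj /andP[Aj Bj]] := inf m.
(* The history first shows the value at [j] at argument [j.+1]. *)
have [k fk] := forces_use (fc j.+1).
pose g i := if i == j then (f j).+1 else f i.
have fg : masked B f = masked B g.
  apply/funext => i; rewrite /masked /g; case: eqP => // ->.
  by rewrite (negPf Bj).
apply: (no g (maxn j.+1 k)).
- by rewrite leq_max ltnW.
- by move=> i im; rewrite /g; case: eqP => // ij; move: im; rewrite ij ltnNge mj.
exists j.+1, (hist (masked A f) j.+1); split; first exact: leq_maxl.
  by apply: forces_leq (leq_maxr _ _) _; apply: forces_masked fk; rewrite fg.
move=> /hist_inj[_ /(_ j (ltnSn j))]; rewrite /masked /g Aj eqxx.
by move=> /eqP; rewrite ltn_eqF.
Qed.

(** * A tree of Turing ideals *)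

(** The column of [s] contains all [pickle (s, i)]; numbers that code no pair fall into the root
    column. *)
Definition column (j : nat) : seq nat :=
  (odflt ([::], 0) (unpickle j : option (seq nat * nat))).1.

Definition columns (s : seq nat) : pred nat := fun j => prefix (column j) s.

Lemma column_unbounded s m : exists2 j, m <= j & column j = s.
Proof.
pose u i := pickle (s, i : nat).
have uI : injective u by move=> i j /(pcan_inj pickleK) [].
have [i mi] : exists i, m <= u i.
  apply: contrapT => no.
  have lt i : u i < m by rewrite ltnNge; apply/negP => le; apply: no; exists i.
  pose v (i : 'I_m.+1) : 'I_m := Ordinal (lt i).
  have /leq_card : injective v by move=> i j [/uI/val_inj].
  by rewrite !card_ord ltnn.
by exists (u i) => //; rewrite /column /u pickleK.
Qed.

(** The witness is the longest common prefix; this form says directly that the columns of [s] and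
    [t] meet in those of [r]. *)
Lemma prefix_meet (T : eqType) (s t : seq T) :
  exists r, forall q, prefix q s && prefix q t = prefix q r.
Proof.
elim: s t => [|x s IH] [|y t].
- by exists [::] => q; rewrite andbb.
- by exists [::] => -[|z q].
- by exists [::] => -[|z q] //=; rewrite andbF.
have [<-|xy] := eqVneq x y; last first.
  exists [::] => -[|z q] //=; apply/negbTE; apply: contra xy.
  by move=> /andP[/andP[/eqP-> _] /andP[/eqP-> _]].
have [r rP] := IH t; exists (x :: r) => -[|z q] //=.
by rewrite -rP; case: (z == x).
Qed.

Definition tree_ideal (H : nat -> nat -> nat) (f : nat -> nat) (s : seq nat) :
    mass_problem :=
  [set x | exists k, turing_le x (oracle_over (H k) (columns s) f)].

Lemma exists_oracle_tower : exists H : nat -> nat -> nat, forall k,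
  [/\ turing_le (H k) (H k.+1),
      forall s, turing_le (remasked (columns s)) (H k.+1),
      forall s t c p,
        turing_le (has_answer (H k) (columns s) (columns t) c p) (H k.+1)
    & forall s t c p,
        turing_le (some_answer (H k) (columns s) (columns t) c p) (H k.+1)].
Proof.
have /choice[next nextP] : forall h, exists h', [/\ turing_le h h',
    forall s, turing_le (remasked (columns s)) h',
    forall s t c p, turing_le (has_answer h (columns s) (columns t) c p) h'
  & forall s t c p, turing_le (some_answer h (columns s) (columns t) c p) h'].
  move=> h; have [h1 P1] := turing_le_countable_family
    (fun s : seq nat => remasked (columns s)).
  (* Trees replace codes here, to have a countable index type. *)
  pose T : countType := (seq nat * seq nat * GenTree.tree nat * seq nat)%type.
  have [h2 P2] := turing_le_countable_family (fun i : T =>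
    has_answer h (columns i.1.1.1) (columns i.1.1.2) (code_of_tree i.1.2 1) i.2).
  have [h3 P3] := turing_le_countable_family (fun i : T =>
    some_answer h (columns i.1.1.1) (columns i.1.1.2) (code_of_tree i.1.2 1) i.2).
  exists (turing_join (turing_join h h1) (turing_join h2 h3)); split.
  - exact: turing_le_trans (turing_le_joinl _ _) (turing_le_joinl _ _).
  - move=> s; apply: turing_le_trans (P1 s) _.
    exact: turing_le_trans (turing_le_joinr _ _) (turing_le_joinl _ _).
  - move=> s t c p; have [u <-] := code_of_tree_surj c.
    apply: turing_le_trans (P2 (s, t, u, p)) _.
    exact: turing_le_trans (turing_le_joinl _ _) (turing_le_joinr _ _).
  - move=> s t c p; have [u <-] := code_of_tree_surj c.
    apply: turing_le_trans (P3 (s, t, u, p)) _.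
    exact: turing_le_trans (turing_le_joinr _ _) (turing_le_joinr _ _).
by exists (fun k => iter k next (fun=> 0)) => k; apply: nextP.
Qed.

Lemma oracle_over_le h h' A f : turing_le h h' ->
  turing_le (oracle_over h A f) (oracle_over h' A f).
Proof.
move=> hh'; apply: turing_join_le; last exact: turing_le_joinr.
exact: turing_le_trans hh' (turing_le_joinl _ _).
Qed.

(** This is all that the algebraic part uses. The third clause comes from genericity for [splits],
    the fourth from genericity for [mispredicts]. *)
Lemma exists_tree_of_ideals : exists I : seq nat -> mass_problem,
  [/\ forall s x y, turing_le y x -> I s x -> I s y,
      forall s, I s (fun=> 0),
      forall s t x, I s x -> I t x ->
        exists r, [/\ prefix r s, prefix r t & I r x]
    & forall s t x, prefix s t -> I s x -> exists y,
        [/\ turing_le x y, I t y & forall r, I r y -> prefix t r]].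
Proof.
have [H HP] := exists_oracle_tower.
have Hle i j : i <= j -> turing_le (H i) (H j).
  move=> /subnKC <-; elim: (j - i) => [|d IH].
    by rewrite addn0; apply: turing_le_refl.
  by rewrite addnS; apply: turing_le_trans IH _; have [] := HP (i + d).
pose T1 : countType :=
  (nat * GenTree.tree nat * GenTree.tree nat * seq nat * seq nat)%type.
pose T2 : countType := (nat * GenTree.tree nat * seq nat * seq nat)%type.
pose D (i : T1 + T2) := match i with
  | inl (k, c, d, s, t) => splits (H k) (columns s) (columns t)
      (code_of_tree c 1) (code_of_tree d 1)
  | inr (k, c, s, t) => mispredicts (H k) (columns s) (columns t)
      (code_of_tree c 1)
  end.
have [|f gen] := @exists_generic _ D.
  move=> [[[[[k c] d] s] t]|[[[k c] s] t]] m f g.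
    exact: splits_agree.
  exact: mispredicts_agree.
pose I := tree_ideal H f.
have mono k s t : prefix s t -> turing_le (oracle_over (H k) (columns s) f)
    (oracle_over (H k.+1) (columns t) f).
  move=> st; have [Hk mk _ _] := HP k; apply: turing_join_le.
    exact: turing_le_trans Hk (turing_le_joinl _ _).
  have -> : hist (masked (columns s) f) =
      (fun n => remasked (columns s) (hist (masked (columns t) f) n)).
    apply/funext => n; rewrite remasked_hist // => j js.
    exact: prefix_trans js st.
  apply: turing_le_comp; last exact: turing_le_joinr.
  exact: turing_le_trans (mk s) (turing_le_joinl _ _).
have Idown s x y : turing_le y x -> I s x -> I s y.
  by move=> yx [k xk]; exists k; apply: turing_le_trans xk.
exists I; split=> //.
- by move=> s; exists 0; exists (Zero 1).
- move=> s t x [i xi] [j xj]; pose k := maxn i j.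
  have {xi}[c xc] : turing_le x (oracle_over (H k) (columns s) f).
    apply: turing_le_trans xi _; apply/oracle_over_le/Hle/leq_maxl.
  have {xj}[d xd] : turing_le x (oracle_over (H k) (columns t) f).
    apply: turing_le_trans xj _; apply/oracle_over_le/Hle/leq_maxr.
  have [r rP] := prefix_meet s t; exists r.
  have /andP[rs rt] : prefix r s && prefix r t by rewrite rP prefix_refl.
  (* The search over level [k] needs the answers stored in [H k.+1]; the union over all levels
     absorbs this shift. *)
  split=> //; exists k.+1.
  have [cs Ec] := code_of_tree_surj c; have [ds Ed] := code_of_tree_surj d.
  have [[m [n [y [z [yz fy fz]]]]]|[m no]] := gen (inl (k, cs, ds, s, t)).
    move: fy fz; rewrite Ec Ed => /forces_inj/(_ (xc n)) ey.
    by move=> /forces_inj/(_ (xd n)) ez; case: yz; rewrite ey ez.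
  rewrite /= Ec Ed in no; have [_ _ hk sk] := HP k.
  apply: (turing_le_intersection no xc xd).
  - exact: turing_le_trans (hk _ _ _ _) (turing_le_joinl _ _).
  - exact: turing_le_trans (sk _ _ _ _) (turing_le_joinl _ _).
  have -> : (predI (columns s) (columns t) : pred nat) = columns r.
    by apply/funext => q; rewrite /= /columns rP.
  exact: turing_le_joinr.
move=> s t x st [k xk]; exists (oracle_over (H k.+1) (columns t) f); split.
- exact: turing_le_trans xk (mono _ _ _ st).
- by exists k.+1; apply: turing_le_refl.
(* If [t] is not a prefix of [r], the unbounded column of [t] lies in [columns t] and misses
   [columns r]. *)
move=> r [j rj]; apply: contrapT => tr.
have /(_ _) := @not_turing_le_masked (H j) (columns t) (columns r) f.
case=> [m|c|].
- have [q mq qt] := column_unbounded t m; exists q => //.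
  by rewrite /columns qt prefix_refl; apply/negP.
- have [cs Ec] := code_of_tree_surj c.
  by have := gen (inr (j, cs, t, r)); rewrite /= Ec.
exact: turing_le_trans (turing_le_joinr _ _) rj.
Qed.

(** * Completeness of IPC for the tree of finite sequences *)

Fixpoint tree_of_formula (p : formula) : GenTree.tree nat :=
  match p with
  | Var n => GenTree.Leaf n
  | Or p q => GenTree.Node 0 [:: tree_of_formula p; tree_of_formula q]
  | And p q => GenTree.Node 1 [:: tree_of_formula p; tree_of_formula q]
  | Imp p q => GenTree.Node 2 [:: tree_of_formula p; tree_of_formula q]
  | Not p => GenTree.Node 3 [:: tree_of_formula p]
  end.

Fixpoint formula_of_tree (t : GenTree.tree nat) : formula :=
  match t with
  | GenTree.Leaf n => Var n
  | GenTree.Node 0 [:: a; b] => Or (formula_of_tree a) (formula_of_tree b)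
  | GenTree.Node 1 [:: a; b] => And (formula_of_tree a) (formula_of_tree b)
  | GenTree.Node 2 [:: a; b] => Imp (formula_of_tree a) (formula_of_tree b)
  | GenTree.Node _ [:: a] => Not (formula_of_tree a)
  | _ => Var 0
  end.

Lemma tree_of_formulaK : cancel tree_of_formula formula_of_tree.
Proof. by elim=> //= [p -> q ->|p -> q ->|p -> q ->|p ->]. Qed.

HB.instance Definition _ := Choice.copy formula (can_type tree_of_formulaK).
HB.instance Definition _ := Countable.copy formula (can_type tree_of_formulaK).

Lemma derivable_sub (G G' : set formula) p :
  G `<=` G' -> derivable G p -> derivable G' p.
Proof.
move=> + Gp; elim: Gp G' => {G p}.
- by move=> G p Gp G' GG'; apply/d_hyp/GG'.
- by move=> G p q _ IH G' GG'; apply/d_or_introl/IH.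
- by move=> G p q _ IH G' GG'; apply/d_or_intror/IH.
- move=> G p q r _ IH1 _ IH2 _ IH3 G' GG'.
  by apply: d_or_elim (IH1 _ GG') (IH2 _ _) (IH3 _ _); apply: setUS.
- by move=> G p q _ IH1 _ IH2 G' GG'; apply: d_and_intro (IH1 _ GG') (IH2 _ _).
- by move=> G p q _ IH G' GG'; apply: d_and_eliml (IH _ GG').
- by move=> G p q _ IH G' GG'; apply: d_and_elimr (IH _ GG').
- by move=> G p q _ IH G' GG'; apply/d_imp_intro/IH/setUS.
- by move=> G p q _ IH1 _ IH2 G' GG'; apply: d_imp_elim (IH1 _ GG') (IH2 _ _).
- move=> G p q _ IH1 _ IH2 G' GG'.
  by apply: d_not_intro (IH1 _ _) (IH2 _ _); apply: setUS.
- by move=> G p q _ IH1 _ IH2 G' GG'; apply: d_not_elim (IH1 _ GG') (IH2 _ _).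
Qed.

Lemma derivable_cut (G : set formula) p q :
  derivable G p -> derivable (p |` G) q -> derivable G q.
Proof. by move=> Gp /d_imp_intro Gpq; apply: d_imp_elim Gpq Gp. Qed.

Lemma setU1_homo (T : Type) (C : nat -> set T) x :
  {homo C : i j / i <= j >-> i `<=` j} ->
  {homo (fun i => x |` C i) : i j / i <= j >-> i `<=` j}.
Proof. by move=> m i j /m; apply: setUS. Qed.

Lemma sub_bigcup_setU1 (T : Type) (C : nat -> set T) (G : set T) x :
  G `<=` \bigcup_i C i -> x |` G `<=` \bigcup_i (x |` C i).
Proof.
by move=> GC y [->|/GC[i _ Cy]]; [exists 0 => //; left|exists i => //; right].
Qed.

(** Increasing chains replace finite subsets: adding a discharged hypothesis to every member gives a
    chain again, so the induction goes through. *)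
Lemma derivable_compact (C : nat -> set formula) (G : set formula) p :
  {homo C : i j / i <= j >-> i `<=` j} -> G `<=` \bigcup_i C i ->
  derivable G p -> exists i, derivable (C i) p.
Proof.
move=> + + Gp; elim: Gp C => {G p}.
- by move=> G p Gp C m /(_ _ Gp)[i _ Cp]; exists i; apply: d_hyp.
- by move=> G p q _ IH C m /(IH _ m)[i ?]; exists i; apply: d_or_introl.
- by move=> G p q _ IH C m /(IH _ m)[i ?]; exists i; apply: d_or_intror.
- move=> G p q r _ IH1 _ IH2 _ IH3 C m GC.
  have [i Ci] := IH1 _ m GC.
  have [j Cj] := IH2 _ (setU1_homo m) (sub_bigcup_setU1 GC).
  have [k Ck] := IH3 _ (setU1_homo m) (sub_bigcup_setU1 GC).
  exists (maxn i (maxn j k)).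
  apply: d_or_elim (derivable_sub _ Ci) (derivable_sub _ Cj) (derivable_sub _ Ck).
  + by apply: m; rewrite leq_max leqnn.
  + by apply/setUS/m; rewrite !leq_max leqnn orbT.
  + by apply/setUS/m; rewrite !leq_max leqnn !orbT.
- move=> G p q _ IH1 _ IH2 C m GC.
  have [i Ci] := IH1 _ m GC; have [j Cj] := IH2 _ m GC; exists (maxn i j).
  apply: d_and_intro (derivable_sub _ Ci) (derivable_sub _ Cj); apply: m.
    exact: leq_maxl.
  exact: leq_maxr.
- by move=> G p q _ IH C m /(IH _ m)[i ?]; exists i; apply: d_and_eliml; eauto.
- by move=> G p q _ IH C m /(IH _ m)[i ?]; exists i; apply: d_and_elimr; eauto.
- move=> G p q _ IH C m GC.
  have [i Ci] := IH _ (setU1_homo m) (sub_bigcup_setU1 GC).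
  by exists i; apply: d_imp_intro.
- move=> G p q _ IH1 _ IH2 C m GC.
  have [i Ci] := IH1 _ m GC; have [j Cj] := IH2 _ m GC; exists (maxn i j).
  apply: d_imp_elim (derivable_sub _ Ci) (derivable_sub _ Cj); apply: m.
    exact: leq_maxl.
  exact: leq_maxr.
- move=> G p q _ IH1 _ IH2 C m GC.
  have [i Ci] := IH1 _ (setU1_homo m) (sub_bigcup_setU1 GC).
  have [j Cj] := IH2 _ (setU1_homo m) (sub_bigcup_setU1 GC).
  exists (maxn i j).
  apply: d_not_intro (derivable_sub _ Ci) (derivable_sub _ Cj); apply/setUS/m.
    exact: leq_maxl.
  exact: leq_maxr.
- move=> G p q _ IH1 _ IH2 C m GC.
  have [i Ci] := IH1 _ m GC; have [j Cj] := IH2 _ m GC; exists (maxn i j).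
  apply: d_not_elim (derivable_sub _ Ci) (derivable_sub _ Cj); apply: m.
    exact: leq_maxl.
  exact: leq_maxr.
Qed.

(** Maximality among the sets not deriving a fixed [q] yields deductive closure, primeness and
    consistency at once. *)
Definition saturated (w : set formula) : Prop :=
  exists2 q, ~ derivable w q & forall r, w r \/ derivable (r |` w) q.

Lemma lindenbaum (G : set formula) q : ~ derivable G q ->
  exists2 w, G `<=` w & saturated w /\ ~ derivable w q.
Proof.
move=> Gq.
(* Stage [i] decides the formula coded by [i]: it is added unless [q] would become derivable. *)
pose add (w : set formula) (i : nat) := if unpickle i is Some r then
  if `[< derivable (r |` w) q >] then w else r |` w else w.
pose C := fix C i := if i is j.+1 then add (C j) j else G.
have CS i : C i `<=` C i.+1.
  rewrite /= /add; case: unpickle => // r.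
  by case: asboolP => _; [apply: subset_refl|apply: subsetUr].
have mono : {homo C : i j / i <= j >-> i `<=` j}.
  move=> i j /subnKC <-; elim: (j - i) => [|d IH]; first by rewrite addn0.
  by rewrite addnS; apply: subset_trans IH (CS _).
have Cq i : ~ derivable (C i) q.
  elim: i => //= i IH; rewrite /add; case: unpickle => // r.
  by case: asboolP.
have uq : ~ derivable (\bigcup_i C i) q.
  by move=> /(derivable_compact mono (fun _ h => h))[i /Cq].
exists (\bigcup_i C i); first by move=> p Gp; exists 0.
split=> //; exists q => // r.
have [rq|rq] := pselect (derivable (r |` C (pickle r)) q); [right|left].
  by apply: derivable_sub rq; apply: setUS => p Cp; exists (pickle r).
exists (pickle r).+1 => //=; rewrite /add pickleK.
by case: asboolP => // _; left.
Qed.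

Section Saturated.
Variables (w : set formula) (w_sat : saturated w).

Lemma saturated_derivable p : derivable w p -> w p.
Proof.
by move=> wp; have [q wq /(_ p)[//|/(derivable_cut wp)]] := w_sat.
Qed.

Lemma saturated_or p q : w (Or p q) <-> w p \/ w q.
Proof.
split=> [wpq|[] wp]; last 2 first.
- exact/saturated_derivable/d_or_introl/d_hyp.
- exact/saturated_derivable/d_or_intror/d_hyp.
have [r wr wP] := w_sat; have [?|pr] := wP p; first by left.
have [?|qr] := wP q; first by right.
by case: wr; apply: d_or_elim (d_hyp wpq) pr qr.
Qed.

Lemma saturated_and p q : w (And p q) <-> w p /\ w q.
Proof.
split=> [/d_hyp wpq|[/d_hyp wp /d_hyp wq]].
  split; apply: saturated_derivable.
    exact: d_and_eliml wpq.
  exact: d_and_elimr wpq.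
exact/saturated_derivable/d_and_intro.
Qed.

Lemma saturated_consistent p : w p -> ~ w (Not p).
Proof.
by have [q wq _] := w_sat => /d_hyp wp /d_hyp wn; apply/wq/d_not_elim/wn.
Qed.

End Saturated.

(** * Kripke semantics on the tree of finite sequences *)

Fixpoint forced (V : nat -> seq nat -> Prop) (p : formula) (s : seq nat) : Prop :=
  match p with
  | Var n => V n s
  | Or p q => forced V p s \/ forced V q s
  | And p q => forced V p s /\ forced V q s
  | Imp p q => forall t, prefix s t -> forced V p t -> forced V q t
  | Not p => forall t, prefix s t -> ~ forced V p t
  end.

Lemma forced_prefix V :
  (forall n s t, prefix s t -> V n s -> V n t) ->
  forall p s t, prefix s t -> forced V p s -> forced V p t.
Proof.
move=> Vmono; elim=> //= [p IHp q IHq|p IHp q IHq|p IHp q IHq|p IHp] s t st.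
- by case=> [/(IHp _ _ st)|/(IHq _ _ st)]; [left|right].
- by case=> [/(IHp _ _ st) ? /(IHq _ _ st)].
- by move=> h u tu; apply/h/(prefix_trans st).
- by move=> h u tu; apply/h/(prefix_trans st).
Qed.

Lemma tree_completeness p : ~ IPC p -> exists V : nat -> seq nat -> Prop,
  (forall n s t, prefix s t -> V n s -> V n t) /\ ~ forced V p [::].
Proof.
move=> /lindenbaum[w0 _ [w0_sat w0p]].
(* Branch [i] serves the pair of formulas coded by [i]: it adds [q] and avoids [r] where possible,
   so every underivable implication fails at a child. *)
have /choice[next nextP] : forall wi : set formula * nat, exists w',
    saturated wi.1 ->
    [/\ saturated w', wi.1 `<=` w' & forall q r, unpickle wi.2 = Some (q, r) ->
      ~ derivable (q |` wi.1) r -> w' q /\ ~ w' r].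
  move=> [w i] /=.
  have [[q [r [e qr]]]|no] := pselect (exists q r,
      unpickle i = Some (q, r) /\ ~ derivable (q |` w) r).
    have [w' sub [w'_sat w'r]] := lindenbaum qr; exists w' => _; split=> //.
      by move=> p' wp'; apply/sub; right.
    rewrite e => _ _ [<- <-] _; split; first by apply: sub; left.
    by move=> /d_hyp.
  exists w => w_sat; split=> // q r e qr; case: no; exists q, r; split=> //.
pose h s := foldl (fun w i => next (w, i)) w0 s.
have hS s i : h (rcons s i) = next (h s, i) by rewrite /h foldl_rcons.
have h_sat s : saturated (h s).
  by elim/last_ind: s => // s i IH; rewrite hS; have [] := nextP (h s, i) IH.
have h_prefix s t : prefix s t -> h s `<=` h t.
  move=> /prefixP[u ->]; elim/last_ind: u => [|u i IH]; first by rewrite cats0.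
  rewrite -rcons_cat hS; apply: subset_trans IH _.
  by have [] := nextP (h (s ++ u), i) (h_sat _).
have h_child s q r : ~ derivable (q |` h s) r ->
    exists t, [/\ prefix s t, h t q & ~ h t r].
  move=> qr; exists (rcons s (pickle (q, r))).
  have [_ _ /(_ q r)] := nextP (h s, pickle (q, r)) (h_sat s).
  by rewrite hS pickleK prefix_rcons => /(_ erefl qr)[].
exists (fun n s => h s (Var n)); split; first by move=> n s t /h_prefix; apply.
suff truth q s : forced (fun n s => h s (Var n)) q s <-> h s q.
  by move=> /truth /d_hyp.
elim: q s => //= [q IHq r IHr|q IHq r IHr|q IHq r IHr|q IHq] s.
- by rewrite IHq IHr saturated_or.
- by rewrite IHq IHr saturated_and.
- split=> [H|sqr t st /IHq tq]; last first.
    apply/IHr/(saturated_derivable (h_sat t)).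
    by apply: d_imp_elim (d_hyp tq); apply/d_hyp/(h_prefix _ _ st).
  apply: contrapT => sqr; have [|t [st /IHq tq tr]] := h_child s q r.
    by move=> /d_imp_intro/(saturated_derivable (h_sat s)).
  by apply/tr/IHr/H.
- split=> [H|sq t st /IHq tq]; last first.
    exact: (saturated_consistent (h_sat t) tq (h_prefix _ _ st _ sq)).
  (* Without a constant for falsity, consistency means that some formula [r] is underivable; a child
     for the pair of [q] and [r] then contains [q]. *)
  apply: contrapT => sq; have [|qr] := pselect (forall r, derivable (q |` h s) r).
    move=> all_derivable; apply/sq/(saturated_derivable (h_sat s)).
    exact: d_not_intro (all_derivable q) (all_derivable _).
  have [r' /h_child[t [st /IHq tq _]]] : exists r, ~ derivable (q |` h s) r.
    by apply: contrapT => no; apply: qr => r; apply: contrapT => ?; apply: no; exists r.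
  exact: (H t st tq).
Qed.

(** * Soundness in Brouwer algebras, and implication of degrees *)

Lemma IPC_sound d (B : brouwerType d) p : IPC p -> Th B p.
Proof.
(* Contexts may be infinite, so any upper bound [c] stands in for the join of the hypotheses. *)
move=> ipc v; suff sound G c : derivable G p ->
    (forall q, G q -> interp v q <= c)%O -> (interp v p <= c)%O.
  by apply/le_anti; rewrite le0x andbT; apply: sound ipc _ => q [].
have extend (G' : set formula) q (a : B) :
    (forall r, G' r -> interp v r <= a)%O ->
    forall r, (q |` G') r -> (interp v r <= interp v q `|` a)%O.
  by move=> Ga r [->|/Ga ra]; rewrite ?leUl // (le_trans ra) ?leUr.
move=> Gp; elim: Gp c => {G p ipc} [G p Gp|G p q _ IH|G p q _ IH|
  G p q r _ IH1 _ IH2 _ IH3|G p q _ IH1 _ IH2|G p q _ IH|G p q _ IH|G p q _ IH|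
  G p q _ IH1 _ IH2|G p q _ IH1 _ IH2|G p q _ IH1 _ IH2] c Gc.
- exact: Gc.
- by apply: le_trans (leIl _ _) _; apply: IH.
- by apply: le_trans (leIr _ _) _; apply: IH.
(* Distributivity splits the join of this meet with [c] into the two cases. *)
- have /join_idPr <- : (interp v p `&` interp v q <= c)%O by apply: IH1.
  rewrite joinIl lexI IH2 ?IH3 //; exact: extend.
- by rewrite /= leUx IH1 ?IH2.
- by apply: le_trans (leUl _ _) (IH c Gc).
- by apply: le_trans (leUr _ _) (IH c Gc).
- by apply/imp_least/IH/extend.
- apply: le_trans (le_join_imp (interp v p) _) _.
  by rewrite leUx IH2 //; apply: IH1.
- apply: imp_least; apply: le_trans (le_join_imp (interp v q) _) _.
  by rewrite leUx IH1 ?[neg _]IH2 //; [apply: IH2|]; apply: extend.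
- apply: le_trans (lex1 _) _; apply: le_trans (le_join_imp (interp v p) _) _.
  by rewrite leUx IH1 //; apply: IH2.
Qed.

Lemma muchnik_le_subset (A B : mass_problem) : A `<=` B -> muchnik_le B A.
Proof. by move=> AB f /AB Bf; exists f => //; apply: turing_le_refl. Qed.

Lemma deg_imp (A B : mass_problem) : imp (deg A) (deg B) = deg (mass_imp A B).
Proof.
apply/le_anti/andP; split.
  by apply: imp_least; rewrite -deg_join; apply/deg_leP/muchnik_le_join_imp.
rewrite -[imp _ _]representativeK; apply/deg_leP/muchnik_imp_least/deg_leP.
by rewrite deg_join representativeK le_join_imp.
Qed.

(** * The Brouwer algebra of the tree of ideals *)

Section TreeOfIdeals.
Variable I : seq nat -> mass_problem.
Hypothesis I_le : forall s x y, turing_le y x -> I s x -> I s y.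
Hypothesis I_0 : forall s, I s (fun=> 0).
Hypothesis I_meet : forall s t x, I s x -> I t x ->
  exists r, [/\ prefix r s, prefix r t & I r x].
Hypothesis I_extend : forall s t x, prefix s t -> I s x -> exists y,
  [/\ turing_le x y, I t y & forall r, I r y -> prefix t r].

(* [level x s]: the p-morphism maps [x] to [s]. *)
Definition level (x : nat -> nat) (s : seq nat) : Prop :=
  I s x /\ forall t, I t x -> prefix s t.

Lemma prefix_anti (s t : seq nat) : prefix s t -> prefix t s -> s = t.
Proof.
move=> st ts; move: (st); rewrite prefixE; have -> : size s = size t.
  by apply/eqP; rewrite eqn_leq !size_prefix.
by rewrite take_size => /eqP.
Qed.

Lemma level_uniq x s t : level x s -> level x t -> s = t.
Proof. by move=> [xs ms] [xt mt]; apply: prefix_anti; [apply: ms|apply: mt]. Qed.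

(** Take [r] of least length. For any [t] with [I t x], [I_meet] gives a common prefix whose ideal
    contains [x], which by minimality is [r]. *)
Lemma level_exists x s : I s x -> exists r, level x r.
Proof.
move=> xs; have ex : exists n, `[< exists2 r, size r = n & I r x >].
  by exists (size s); apply/asboolP; exists s.
have [_ /asboolP[r <- xr] rmin] := ex_minnP ex; exists r; split=> // t xt.
have [q [qr qt xq]] := I_meet xr xt.
suff -> : r = q by [].
have sz : size r <= size q by apply: rmin; apply/asboolP; exists q.
have := qr; rewrite prefixE.
have -> : size q = size r by apply/eqP; rewrite eqn_leq sz size_prefix.
by rewrite take_size => /eqP.
Qed.

(** Functions outside all ideals have no level and belong to every such problem. *)
Definition at_levels (S : seq nat -> Prop) : mass_problem :=
  [set x | forall s, level x s -> S s].

Local Notation up S := (forall s t, prefix s t -> S s -> S t).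

(** Levels are monotone: the level of [x] is a prefix of that of [y]. *)
Lemma at_levels_le (S : seq nat -> Prop) x y :
  up S -> turing_le x y -> at_levels S x -> at_levels S y.
Proof.
move=> upS xy Sx s [ys _].
have [r xr] := level_exists (I_le xy ys).
exact/upS/Sx/xr/(proj2 xr)/I_le/ys.
Qed.

Lemma deg_at_levels_or (S T : seq nat -> Prop) :
  (deg (at_levels S) `&` deg (at_levels T))%O =
  deg (at_levels (fun s => S s \/ T s)).
Proof.
rewrite -deg_meet; apply/deg_eq; split; last first.
  by apply/muchnik_le_meet; split; apply: muchnik_le_subset => x Sx s /Sx;
    [left|right].
move=> x STx; have [Sx|nSx] := pselect (at_levels S x).
  exists (fun_cons 0 x); last exact: turing_cons_le.
  by left; exists x.
exists (fun_cons 1 x); last exact: turing_cons_le.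
right; exists x => // s xs; have [Ss|//] := STx s xs.
by case: nSx => t xt; rewrite (level_uniq xt xs).
Qed.

Lemma deg_at_levels_and (S T : seq nat -> Prop) : up S -> up T ->
  (deg (at_levels S) `|` deg (at_levels T))%O =
  deg (at_levels (fun s => S s /\ T s)).
Proof.
move=> upS upT; rewrite -deg_join; apply/deg_eq; split.
  by apply/muchnik_join_le; split; apply: muchnik_le_subset => x STx s /STx[].
apply: muchnik_le_subset => _ [x Sx [y Ty <-]] s xys; split.
  exact: (at_levels_le upS (turing_le_joinl x y)) xys.
exact: (at_levels_le upT (turing_le_joinr x y)) xys.
Qed.

(** One inclusion uses that levels are monotone, the other the back condition [I_extend] of the
    p-morphism. *)
Lemma deg_at_levels_imp (S T : seq nat -> Prop) : up S -> up T ->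
  imp (deg (at_levels S)) (deg (at_levels T)) =
  deg (at_levels (fun s => forall t, prefix s t -> S t -> T t)).
Proof.
move=> upS upT; rewrite deg_imp; apply/deg_eq; split; apply: muchnik_le_subset.
  move=> y STy x Sx; exists (turing_join x y); last exact: turing_le_refl.
  move=> s xys; have [ys _] := xys.
  have [r yr] := level_exists (I_le (turing_le_joinr x y) ys).
  apply: (STy r yr).
    exact/(proj2 yr)/I_le/ys/turing_le_joinr.
  exact: (at_levels_le upS (turing_le_joinl x y) Sx).
(* Both [x] and its join with [y] have level exactly [t]. *)
move=> y STy s [ys _] t st St; have [x [yx xt tmin]] := I_extend st ys.
have [|z Tz zxy] := STy x.
  by move=> r xr; rewrite (@level_uniq x r t).
have := at_levels_le upT zxy Tz; apply; split.
  exact: I_le (turing_join_le (turing_le_refl x) yx) xt.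
by move=> r /(I_le (turing_le_joinl x y))/tmin.
Qed.

Lemma tree_Th_sub_IPC :
  Th (initial_segment (deg (at_levels (fun=> False)))) `<=` IPC.
Proof.
set Y := at_levels _; move=> p pY; apply: contrapT.
move=> /tree_completeness[V [V_up]]; apply.
have Yle S : (deg (at_levels S) <= deg Y)%O.
  by apply/deg_leP/muchnik_le_subset => x Yx s /Yx.
pose v n : initial_segment (deg Y) := InitialSegment (Yle (V n)).
have up q := @forced_prefix V V_up q.
have interpE q : segment_val (interp v q) = deg (at_levels (forced V q)).
  elim: q => //= [q IHq r IHr|q IHq r IHr|q IHq r IHr|q IHq].
  - by rewrite -deg_at_levels_or -IHq -IHr.
  - by rewrite -(deg_at_levels_and (up q) (up r)) -IHq -IHr.
  - by rewrite -(deg_at_levels_imp (up q) (up r)) -IHq -IHr.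
  (* The top of the segment is the degree of the empty set of levels, so negation is implication
     into [False]. *)
  - transitivity (imp (segment_val (interp v q)) (deg Y)) => //.
    by rewrite IHq; apply: (@deg_at_levels_imp _ (fun=> False) (up q)).
have /(congr1 (@segment_val _ _ _)) := pY v.
rewrite interpE => /deg_eq_bot[x px cx].
(* A computable function has the root [[::]] as its level. *)
apply: px; split; first exact: I_le cx (I_0 _).
by move=> t _; apply: prefix0s.
Qed.

End TreeOfIdeals.

Theorem theorem4p4 :
  exists Y : mass_problem, Th (initial_segment (deg Y)) = IPC.
Proof.
have [I [I_le I_0 I_meet I_extend]] := exists_tree_of_ideals.
(* These are the functions without a level, that is, those outside every ideal. *)
exists (at_levels I (fun=> False)); apply/seteqP; split.
  exact: tree_Th_sub_IPC.
by move=> p; apply: IPC_sound.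
Qed.
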